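(* Let $n\ge2$ and let $G_1,G_2,\dots,G_n$ be simple unweighted graphs, with $G_1$ having no isolated vertices. If $G_1$ is exact, then the lexicographic product $G_1\bullet G_2\bullet\cdots\bullet G_n$ is exact.
   Context: All graphs are finite with nonempty vertex set, simple and unweighted (every edge has weight $1$). The lexicographic product of $G_1=(V_1,E_1)$ and $G_2=(V_2,E_2)$ is the graph $G_1\bullet G_2$ with vertex set $V_1\times V_2$, where $(u,v)$ and $(u',v')$ are adjacent if either $uu'\in E_1$, or $u=u'$ and $vv'\in E_2$; this operation is associative. The Laplacian $\mathcal{L}_G$ of a graph $G=(V,E)$ with edge weights $w_{ij}$ ($w_{ij}=0$ for non-edges) is the $V\times V$ matrix with off-diagonal entries $-w_{ij}$ and diagonal entries $\sum_{j\ne i}w_{ij}$. The MAXCUT SDP of $G$ is: maximize $\frac14\langle \mathcal{L}_G,\mathbf{X}\rangle$ over symmetric matrices $\mathbf{X}\in\mathbb{R}^{V\times V}$ with $X_{ii}=1$ for all $i\in V$ and $\mathbf{X}\succeq \mathbf{0}$, where $\langle \mathbf{A},\mathbf{B}\rangle=\operatorname{tr}(\mathbf{A}\mathbf{B})$. $\mathrm{MAXCUT}(G)$ is the maximum, over partitions $(S,V\setminus S)$ of $V$, of the total weight of edges with exactly one endpoint in $S$. $G$ is called exact if the optimal value of the MAXCUT SDP of $G$ equals $\mathrm{MAXCUT}(G)$; equivalently, if the MAXCUT SDP has an optimal solution of rank $1$. *)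

(* Defs.v *)
From HB Require Import structures.
From mathcomp Require Import all_boot all_order all_algebra.
From mathcomp Require Import boolp classical_sets reals.

Set Implicit Arguments.
Unset Strict Implicit.
Unset Printing Implicit Defensive.

Import Order.TTheory GRing.Theory Num.Theory.
Local Open Scope ring_scope.

Record sgraph := SGraph {
  vertex :> finType;
  adj : rel vertex;
  adj_sym : symmetric adj;
  adj_irrefl : irreflexive adj;
  vertex_gt0 : (0 < #|vertex|)%N }.

Arguments adj {s}.

Definition no_isolated_vertex (G : sgraph) := forall u : G, exists v : G, adj u v.

Section Lexicographic.
Variables G1 G2 : sgraph.

Definition lex_adj : rel (G1 * G2)%type :=
  fun p q => adj p.1 q.1 || (p.1 == q.1) && adj p.2 q.2.

Lemma lex_adj_sym : symmetric lex_adj.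
Proof.
by move=> p q; rewrite /lex_adj adj_sym eq_sym [in X in _ || X]adj_sym.
Qed.

Lemma lex_adj_irrefl : irreflexive lex_adj.
Proof. by move=> p; rewrite /lex_adj !adj_irrefl andbF. Qed.

Lemma lex_vertex_gt0 : (0 < #|{: G1 * G2}|)%N.
Proof. by rewrite card_prod muln_gt0 !vertex_gt0. Qed.

Definition lexprod := SGraph lex_adj_sym lex_adj_irrefl lex_vertex_gt0.

End Lexicographic.

(* ((G 1 • G 2) • ...) • G n for n >= 1; the operation is associative only up
   to isomorphism, so a bracketing has to be fixed. *)
Definition lexprod_iter (G : nat -> sgraph) (n : nat) : sgraph :=
  foldl lexprod (G 1%N) [seq G i | i <- index_iota 2%N n.+1].

Definition edges (G : sgraph) : {set {set G}} :=
  [set [set p.1; p.2] | p : G * G & adj p.1 p.2].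

Definition cut_edges (G : sgraph) (S : {set G}) : {set {set G}} :=
  [set e in edges G | #|e :&: S| == 1]%N.

(* All weights are 1, so the weight of a cut is its number of edges. *)
Definition maxcut (G : sgraph) : nat := (\max_(S : {set G}) #|cut_edges S|)%N.

Section MaxcutSDP.
Variables (R : realType) (G : sgraph).

Definition weight (u v : G) : R := (adj u v)%:R.

(* Rows and columns are indexed by the vertices through [enum_val]. *)
Definition laplacian : 'M[R]_#|G| :=
  \matrix_(i, j) if i == j then \sum_(k | k != i) weight (enum_val i) (enum_val k)
                 else - weight (enum_val i) (enum_val j).

Definition psdmx n (X : 'M[R]_n) := forall x : 'cV[R]_n, 0 <= (x^T *m X *m x) 0 0.

Definition sdp_feasible (X : 'M[R]_#|G|) :=
  [/\ X^T = X, forall i, X i i = 1 & psdmx X].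

Definition sdp_objective (X : 'M[R]_#|G|) : R := 4^-1 * \tr (laplacian *m X).

Local Open Scope classical_set_scope.

Definition sdp_values : set R := [set sdp_objective X | X in sdp_feasible].

Definition sdp_opt : R := sup sdp_values.

Lemma sdp_feasible_le1 X i j : sdp_feasible X -> `|X i j| <= 1.
Proof.
move=> [Xsym X1 Xpsd].
have Xji : X j i = X i j by rewrite -[in RHS]Xsym mxE.
have quad (a : R) : 0 <= 1 + a * X i j + (a * X i j + a * a).
  have := Xpsd (delta_mx i 0 + a *: delta_mx j 0).
  have -> : (delta_mx i 0 + a *: delta_mx j 0)^T
            = delta_mx 0 i + a *: delta_mx 0 j :> 'rV[R]_#|G|.
    by rewrite linearD linearZ /= !trmx_delta.
  rewrite !mulmxDl -!scalemxAl !mulmxDr.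
  rewrite -!scalemxAr -!rowE -!colE !mxE !X1 Xji mulr1.
  by rewrite mulrDr.
rewrite ler_norml; apply/andP; split.
  have := quad 1; rewrite !mul1r addrACA [X in _ + X]addrC -mulr2n pmulrn_lge0 //.
  by rewrite -lerBlDl sub0r.
have := quad (-1); rewrite !mulN1r opprK addrACA [X in _ + X]addrC.
by rewrite -mulr2n pmulrn_lge0 // subr_ge0.
Qed.

(* [sup] is the genuine supremum here, not its default value. *)
Lemma has_sup_sdp_values : has_sup sdp_values.
Proof.
split.
  exists (sdp_objective 1%:M), 1%:M => //; split.
  - by rewrite trmx1.
  - by move=> i; rewrite mxE eqxx.
  - move=> x; rewrite mulmx1 mxE; apply: sumr_ge0 => i _.
    by rewrite mxE -expr2 sqr_ge0.
exists (4^-1 * \sum_i \sum_j `|laplacian i j|) => _ [X fX <-].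
rewrite /sdp_objective ler_pM2l ?invr_gt0 ?ltr0n //.
apply: ler_sum => i _; rewrite mxE; apply: ler_sum => j _.
apply: le_trans (ler_norm _) _; rewrite normrM ler_piMr //.
exact: sdp_feasible_le1.
Qed.

Definition exact_graph := sdp_opt = (maxcut G)%:R.

End MaxcutSDP.

(* Main.v *)
Require Import Defs.
From mathcomp Require Import all_boot all_order all_algebra.
From mathcomp Require Import reals.
From mathcomp Require Import ring lra.

(** It suffices to treat one product [lexprod G H] with [G] exact and without
isolated vertices: the product again has no isolated vertex, so the general
case follows by iterating.

Write A for the adjacency matrix of [G], m for the order of [H], and let s be
the sign vector of a maximum cut of [G].  Exactness says that s s^T maximizes
the SDP of [G].  Two consequences carry the proof.

- Second-order optimality ([sum_slack_ge0]).  Perturbing s s^T inside the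
  feasible set in the direction of an arbitrary positive semidefinite Y shows
  that <Z, Y> >= 0 for Z = diag(g) + A, where
  g_u = - \sum_v A_uv s_u s_v is the number of cut edges at u minus the number
  of uncut ones.  So Z is the dual slack matrix of the SDP, obtained without
  any appeal to conic duality.
- Integrality ([gain_gt0], [gain_side_int]).  A positive semidefinite matrix
  with a diagonal entry <= 0 has a zero row there, whereas row u of Z contains
  a 1 for each neighbour of u.  Hence g_u > 0, and as g_u is an integer,
  g_u >= 1.

Now let M be feasible for the product and let Y be its mean over pairs of
fibres.  The edges between distinct fibres contribute
m^2 / 4 \sum_uv A_uv (1 - Y_uv) to the objective.  Those inside the fibre of u
contribute at most m^2 / 4 (1 - Y_uu), the value obtained when [H] is replaced
by a complete graph ([cutform_lexprod_le]).  Since <Z, Y> >= 0 and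
\sum_u g_u = 4 maxcut(G) - \sum_uv A_uv, the total is at most
m^2 (maxcut(G) - 1/4 \sum_u (g_u - 1) (1 - Y_uu)) <= m^2 maxcut(G).
Conversely, if S is a maximum cut of [G], the cut S x H of the product has
m^2 maxcut(G) edges, so both optima of the product equal m^2 maxcut(G). *)

Set Implicit Arguments.
Unset Strict Implicit.
Unset Printing Implicit Defensive.

Import Order.TTheory GRing.Theory Num.Theory.
Local Open Scope ring_scope.

(** * Positive semidefinite kernels *)

Section Kernels.
Variables (R : realType) (T : finType).
Implicit Types (M Y : T -> T -> R) (s x : T -> R).

Definition quad M x := \sum_u \sum_v x u * M u v * x v.

Definition psdker M := (forall u v, M u v = M v u) /\ forall x, 0 <= quad M x.

(** The feasible set of the MAXCUT SDP, indexed by vertices instead of by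
ordinals. *)
Definition elliptope M := psdker M /\ forall u, M u u = 1.

Definition rank1 x : T -> T -> R := fun u v => x u * x v.

Lemma sum_delta (F : T -> R) u : \sum_v (v == u)%:R * F v = F u.
Proof.
rewrite (bigD1 u) //= eqxx mul1r big1 ?addr0 // => v /negPf ->.
by rewrite mul0r.
Qed.

Lemma quad_rank1 s x : quad (rank1 s) x = (\sum_u x u * s u) ^+ 2.
Proof.
rewrite /quad expr2 mulr_suml; apply: eq_bigr => u _.
by rewrite mulr_sumr; apply: eq_bigr => v _; rewrite /rank1; ring.
Qed.

Lemma psdker_rank1 s : psdker (rank1 s).
Proof.
split=> [u v|x]; first by rewrite /rank1 mulrC.
by rewrite quad_rank1 sqr_ge0.
Qed.

Lemma elliptope_rank1 s : (forall u, s u * s u = 1) -> elliptope (rank1 s).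
Proof. by move=> s2; split=> [|u]; [exact: psdker_rank1 | exact: s2]. Qed.

Lemma psdker_diag_ge0 M u : psdker M -> 0 <= M u u.
Proof.
case=> _ /(_ (fun v => (v == u)%:R)); rewrite /quad.
under eq_bigr => v _.
  under eq_bigr => w _ do rewrite mulrC.
  rewrite (sum_delta (fun w => (v == u)%:R * M v w)).
  over.
by rewrite (sum_delta (M ^~ u)).
Qed.

Lemma psdkerD M Y : psdker M -> psdker Y -> psdker (fun u v => M u v + Y u v).
Proof.
move=> [Ms Mp] [Ys Yp]; split=> [u v|x]; first by rewrite Ms Ys.
suff -> : quad (fun u v => M u v + Y u v) x = quad M x + quad Y x.
  exact: addr_ge0.
rewrite /quad -big_split; apply: eq_bigr => u _ /=.
by rewrite -big_split; apply: eq_bigr => v _ /=; ring.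
Qed.

Lemma psdkerZ (c : R) M : 0 <= c -> psdker M -> psdker (fun u v => c * M u v).
Proof.
move=> c0 [Ms Mp]; split=> [u v|x]; first by rewrite Ms.
suff -> : quad (fun u v => c * M u v) x = c * quad M x by exact: mulr_ge0.
rewrite /quad mulr_sumr; apply: eq_bigr => u _.
by rewrite mulr_sumr; apply: eq_bigr => v _; ring.
Qed.

Lemma psdker_congr M (r : T -> R) :
  psdker M -> psdker (fun u v => r u * M u v * r v).
Proof.
move=> [Ms Mp]; split=> [u v|x]; first by rewrite Ms; ring.
apply: le_trans (Mp (fun u => x u * r u)) _; rewrite le_eqVlt; apply/orP; left.
apply/eqP/eq_bigr => u _; apply: eq_bigr => v _; ring.
Qed.

(** If Y is the Gram matrix of vectors a_u, this is the Gram matrix of the unit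
vectors ((1 - e |a_u|^2) s_u, 2 sqrt(e) a_u) / (1 + e |a_u|^2), a rational
parametrization of a path of feasible points leaving s s^T.  Written with
entries of Y only, it requires neither a Gram factorization nor square
roots. *)
Definition tilt s Y (e : R) : T -> T -> R := fun u v =>
  (1 + e * Y u u)^-1
  * (rank1 (fun w => s w * (1 - e * Y w w)) u v + 4 * e * Y u v)
  * (1 + e * Y v v)^-1.

Lemma elliptope_tilt s Y e : (forall u, s u * s u = 1) -> psdker Y -> 0 < e ->
  elliptope (tilt s Y e).
Proof.
move=> s2 Yp e0; split.
  apply: (psdker_congr (fun u => (1 + e * Y u u)^-1)).
  apply: psdkerD; first exact: psdker_rank1.
  by apply: psdkerZ => //; rewrite mulr_ge0 // ltW.
move=> u; have Yu := mulr_ge0 (ltW e0) (psdker_diag_ge0 u Yp).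
have n0 : 1 + e * Y u u != 0 by rewrite gt_eqF // ltr_pwDl.
rewrite /tilt /rank1.
have -> : s u * (1 - e * Y u u) * (s u * (1 - e * Y u u))
  = (s u * s u) * (1 - e * Y u u) ^+ 2 by ring.
by rewrite s2; field.
Qed.

(** The increment along the path is exactly the first-order term in [e] times
weights that tend to 1, because (1 - a) (1 - b) - (1 + a) (1 + b) is linear in
a and b. *)
Lemma tilt_sub s Y e u v : psdker Y -> 0 < e ->
  tilt s Y e u v - s u * s v =
  2 * e * ((2 * Y u v - s u * s v * (Y u u + Y v v))
           * ((1 + e * Y u u)^-1 * (1 + e * Y v v)^-1)).
Proof.
move=> Yp e0.
have n0 w : 1 + e * Y w w != 0.
  by rewrite gt_eqF // ltr_pwDl // (mulr_ge0 (ltW e0) (psdker_diag_ge0 w Yp)).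
have := n0 u; have := n0 v; rewrite /tilt /rank1 => nv nu.
by field; rewrite nu nv.
Qed.

Lemma tilt_weight_le (a b e : R) : 0 <= a -> 0 <= b -> 0 < e ->
  `|(1 + e * a)^-1 * (1 + e * b)^-1 - 1| <= e * (a + b).
Proof.
move=> a0 b0 e0.
have ea : 0 <= e * a by rewrite mulr_ge0 // ltW.
have eb : 0 <= e * b by rewrite mulr_ge0 // ltW.
rewrite mulrDr; move: (e * a) (e * b) ea eb => {a0 b0} a' b' a0 b0.
have p0 : 0 < (1 + a') * (1 + b') by rewrite mulr_gt0 // ltr_pwDl.
rewrite -invfM ler0_norm; last by rewrite subr_le0 invf_le1 //; nra.
rewrite opprB lerBlDr -lerBlDl -[leRHS]mul1r ler_pdivlMr //.
have ab := mulr_ge0 a0 b0.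
have aab := mulr_ge0 ab (addr_ge0 a0 b0).
have a2 := sqr_ge0 a'; have b2 := sqr_ge0 b'.
nra.
Qed.

End Kernels.

(** * The SDP and the cuts of one graph *)

Section Cuts.
Variables (R : realType) (G : sgraph).
Implicit Types (M Y : G -> G -> R) (s x : G -> R) (S : {set G}).

Local Notation A := (@weight R G).

Definition cutform M : R := 4^-1 * \sum_u \sum_v A u v * (1 - M u v).

Definition mx_of_ker M : 'M[R]_#|G| :=
  \matrix_(i, j) M (enum_val i) (enum_val j).

Definition ker_of_mx (X : 'M[R]_#|G|) : G -> G -> R :=
  fun u v => X (enum_rank u) (enum_rank v).

Lemma sum_enum_val (F : G -> R) : \sum_(i < #|G|) F (enum_val i) = \sum_u F u.
Proof.
rewrite (reindex (@enum_rank G)); last exact/onW_bij/enum_rank_bij.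
by apply: eq_bigr => u _; rewrite enum_rankK.
Qed.

Lemma ker_of_mxK X : mx_of_ker (ker_of_mx X) = X.
Proof. by apply/matrixP => i j; rewrite mxE /ker_of_mx !enum_valK. Qed.

Lemma quad_mx_of_ker M (x : G -> R) :
  ((\col_i x (enum_val i))^T *m mx_of_ker M *m \col_i x (enum_val i)) 0 0
  = quad M x.
Proof.
rewrite mxE /quad exchange_big -sum_enum_val; apply: eq_bigr => i _ /=.
rewrite !mxE mulr_suml -sum_enum_val.
by apply: eq_bigr => j _; rewrite !mxE.
Qed.

Lemma sdp_feasible_mx_of_ker M : sdp_feasible (mx_of_ker M) <-> elliptope M.
Proof.
split=> [[Ms M1 Mp]|[[Ms Mp] M1]].
  have E u v : M u v = mx_of_ker M (enum_rank u) (enum_rank v).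
    by rewrite mxE !enum_rankK.
  split; last by move=> u; rewrite E M1.
  split=> [u v|x]; first by rewrite !E -[in LHS]Ms mxE.
  by rewrite -quad_mx_of_ker; exact: Mp.
split; first by apply/matrixP => i j; rewrite !mxE Ms.
  by move=> i; rewrite mxE M1.
move=> x; have -> : x = \col_i x (enum_rank (enum_val i : G)) 0.
  by apply/matrixP => i j; rewrite mxE enum_valK ord1.
by rewrite (quad_mx_of_ker M (fun u => x (enum_rank u) 0)); exact: Mp.
Qed.

Lemma sdp_objective_mx_of_ker M :
  elliptope M -> sdp_objective (mx_of_ker M) = cutform M.
Proof.
move=> [[Ms _] M1]; rewrite /sdp_objective /cutform; congr (_ * _).
rewrite /mxtrace -sum_enum_val; apply: eq_bigr => i _; rewrite mxE.
rewrite -sum_enum_val (bigD1 i) //= [RHS](bigD1 i) //= !mxE eqxx !M1.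
rewrite subrr mulr0 add0r mulr1 -big_split; apply: eq_bigr => j ji /=.
by rewrite !mxE eq_sym (negPf ji) Ms; ring.
Qed.

Lemma cutform_le_opt M : elliptope M -> cutform M <= sdp_opt R G.
Proof.
move=> Me; rewrite -sdp_objective_mx_of_ker //.
apply: ub_le_sup; first by case: (has_sup_sdp_values R G).
by exists (mx_of_ker M) => //; apply/sdp_feasible_mx_of_ker.
Qed.

Lemma sdp_opt_le (c : R) :
  (forall M, elliptope M -> cutform M <= c) -> sdp_opt R G <= c.
Proof.
move=> Mc; apply: ge_sup; first by case: (has_sup_sdp_values R G).
move=> _ [X + <-]; rewrite -(ker_of_mxK X) => /sdp_feasible_mx_of_ker Xe.
by rewrite sdp_objective_mx_of_ker //; exact: Mc.
Qed.

Lemma elliptope_le1 M u v : elliptope M -> M u v <= 1.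
Proof.
move=> /sdp_feasible_mx_of_ker /(sdp_feasible_le1 (enum_rank u) (enum_rank v)).
by rewrite mxE !enum_rankK; apply: le_trans; exact: ler_norm.
Qed.

Definition side S : G -> R := fun u => (-1) ^+ (u \in S).

Lemma side_sqr S u : side S u * side S u = 1.
Proof. by rewrite -expr2 sqrr_sign. Qed.

(** Each cut edge has a unique orientation from [S] to its complement. *)
Lemma card_cut_edges S :
  #|cut_edges S|
  = #|[set p : G * G | [&& adj p.1 p.2, p.1 \in S & p.2 \notin S]]|.
Proof.
have inS (p : G * G) : p.1 \in S -> p.2 \notin S ->
    [set p.1; p.2] :&: S = [set p.1] /\ [set p.1; p.2] :\: S = [set p.2].
  move=> p1 p2; split; apply/setP => w; rewrite !inE.
    by case: eqP => [->|_] //=; case: eqP => [->|_] //=; exact: negbTE.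
  case: (w =P p.2) => [->|_] /=; first by rewrite p2 orbT.
  by case: eqP => [->|_] /=; rewrite ?p1 ?andbF.
rewrite -(card_in_imset (f := fun p : G * G => [set p.1; p.2])); last first.
  move=> p q; rewrite !inE => /and3P[_ p1 p2] /and3P[_ q1 q2] pq.
  have [e1 e2] := inS _ p1 p2; have [f1 f2] := inS _ q1 q2.
  apply/eqP; rewrite -pair_eqE; apply/andP; split.
    by apply/eqP/set1_inj; rewrite -e1 -f1 pq.
  by apply/eqP/set1_inj; rewrite -e2 -f2 pq.
apply: eq_card => e; rewrite inE; apply/andP/imsetP => [[]|[p + ->]].
  case/imsetP => p; rewrite inE => pe ->.
  have pne : p.1 != p.2.
    by apply: contraTneq pe => ->; rewrite adj_irrefl.
  have [p1|p1] := boolP (p.1 \in S); have [p2|p2] := boolP (p.2 \in S).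
  - have /setIidPl -> : [set p.1; p.2] \subset S.
      by apply/subsetP => w; rewrite !inE => /orP[]/eqP->.
    by rewrite cards2 pne.
  - by exists p => //; rewrite inE pe p1 p2.
  - exists (p.2, p.1); last exact: setUC.
    by rewrite inE /= adj_sym pe p2 p1.
  - suff -> : [set p.1; p.2] :&: S = set0 by rewrite cards0.
    apply/setP => w; rewrite !inE.
    by case: eqP => [->|_] /=; last case: eqP => [->|_] //=; apply: negbTE.
rewrite inE => /and3P[pe p1 p2]; split.
  by apply/imsetP; exists p; rewrite ?inE.
by have [-> _] := inS _ p1 p2; rewrite cards1.
Qed.

(** The objective sums over ordered pairs: each cut edge occurs twice, each time
with 1 - s_u s_v = 2, which cancels the factor 1/4. *)
Lemma cutform_side S : cutform (rank1 (side S)) = #|cut_edges S|%:R.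
Proof.
pose c u v : R := A u v * ((u \in S) && (v \notin S))%:R.
have As u v : A u v = A v u by rewrite /weight adj_sym.
have -> : #|cut_edges S|%:R = \sum_u \sum_v c u v.
  rewrite card_cut_edges -sum1_card natr_sum pair_big /= big_mkcond /=.
  apply: eq_bigr => p _; rewrite inE /c /weight.
  by case: (adj p.1 p.2); do 2?case: (_ \in S); rewrite /= ?mul1r ?mul0r.
rewrite /cutform (eq_bigr (fun u => \sum_v 2 * (c u v + c v u))); last first.
  move=> u _; apply: eq_bigr => v _; rewrite /c (As v) /rank1 /side.
  by case: (u \in S); case: (v \in S) => /=; rewrite ?expr0 ?expr1; ring.
under eq_bigr => u _ do rewrite -mulr_sumr big_split /=.
rewrite -mulr_sumr big_split /= [X in _ + X]exchange_big /=.
by move: (\sum_u _) => t; field.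
Qed.

Lemma maxcut_attained : exists S, maxcut G = #|cut_edges S|.
Proof.
have G0 : (0 < #|{set G}|)%N by apply/card_gt0P; exists set0.
have [S e] := @bigop.eq_bigmax _ (fun S : {set G} => #|cut_edges S|) G0.
by exists S.
Qed.

Lemma maxcut_le_opt : (maxcut G)%:R <= sdp_opt R G.
Proof.
have [S ->] := maxcut_attained; rewrite -cutform_side.
by apply: cutform_le_opt; apply: elliptope_rank1; exact: side_sqr.
Qed.

(** For a sign vector [s], the decrease of the cut when [u] changes sides. *)
Definition gain s u : R := - \sum_v A u v * (s u * s v).

(** Four times the slack matrix of the dual SDP at the multipliers which make it
annihilate [s]. *)
Definition slack s : G -> G -> R := fun u v => (v == u)%:R * gain s u + A u v.

Lemma sum_slackE s Y : \sum_u \sum_v slack s u v * Y u v =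
  \sum_u gain s u * Y u u + \sum_u \sum_v A u v * Y u v.
Proof.
rewrite -big_split; apply: eq_bigr => u _ /=.
rewrite -(sum_delta (fun v => gain s u * Y u v)) -big_split.
by apply: eq_bigr => v _; rewrite /slack /=; ring.
Qed.

Lemma cutform_gain s :
  4 * cutform (rank1 s) = \sum_u \sum_v A u v + \sum_u gain s u.
Proof.
rewrite /cutform mulVKf ?pnatr_eq0 // -big_split; apply: eq_bigr => u _ /=.
rewrite /gain -sumrN -big_split; apply: eq_bigr => v _ /=.
by rewrite /rank1; ring.
Qed.

Section OptimalCut.
Variable s : G -> R.
Hypothesis s_sqr : forall u, s u * s u = 1.
Hypothesis s_opt : forall M, elliptope M -> cutform M <= cutform (rank1 s).

(** The first-order change of the objective along [tilt s Y] is a negative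
multiple of the left-hand sum, and optimality of s s^T makes it nonpositive. *)
Lemma sum_slack_ge0 Y : psdker Y -> 0 <= \sum_u \sum_v slack s u v * Y u v.
Proof.
move=> Yp.
(* [q] is the derivative of the path at 0, up to the factor 2, and [w e] the
   weight that tends to 1 with [e]. *)
pose q u v := 2 * Y u v - s u * s v * (Y u u + Y v v).
pose w e u v := (1 + e * Y u u)^-1 * (1 + e * Y v v)^-1.
pose Q := \sum_u \sum_v A u v * q u v.
have QE : Q = 2 * \sum_u \sum_v slack s u v * Y u v.
  have gE : \sum_u gain s u * Y u u
      = - \sum_u \sum_v A u v * (s u * s v) * Y u u.
    rewrite -sumrN; apply: eq_bigr => u _.
    by rewrite /gain mulNr mulr_suml.
  have gE' : \sum_u gain s u * Y u u
      = - \sum_u \sum_v A u v * (s u * s v) * Y v v.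
    rewrite gE exchange_big; congr (- _); apply: eq_bigr => u _ /=.
    apply: eq_bigr => v _.
    by rewrite {1}/weight adj_sym -/(A u v); ring.
  rewrite sum_slackE mulrDr [2 * \sum_u gain _ _ * _]mulr_natl mulr2n.
  rewrite {1}gE gE' mulr_sumr -!sumrN -!big_split; apply: eq_bigr => u _ /=.
  rewrite mulr_sumr -!sumrN -!big_split; apply: eq_bigr => v _ /=.
  by rewrite /q; ring.
suff : 0 <= Q by rewrite QE pmulr_rge0.
have Qw e : 0 < e -> 0 <= \sum_u \sum_v A u v * (q u v * w e u v).
  move=> e0; have := s_opt (elliptope_tilt s_sqr Yp e0).
  rewrite -subr_ge0 /cutform -mulrBr pmulr_rge0 ?invr_gt0 // -sumrB => h.
  have e2 : 0 < 2 * e by rewrite mulr_gt0.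
  rewrite -(pmulr_rge0 _ e2) mulr_sumr; apply: le_trans h _.
  rewrite le_eqVlt; apply/orP; left; apply/eqP/eq_bigr => u _.
  rewrite mulr_sumr -sumrB; apply: eq_bigr => v _.
  rewrite -mulrBr mulrCA -tilt_sub //; congr (_ * _).
  by rewrite /rank1; ring.
(* Replacing the weights by 1 costs at most [e * C]; [e] then tends to 0. *)
pose C := \sum_u \sum_v A u v * (`|q u v| * (Y u u + Y v v)).
have A0 u v : 0 <= A u v by rewrite ler0n.
have Y0 u : 0 <= Y u u by exact: psdker_diag_ge0.
have C0 : 0 <= C.
  by do 2!(apply: sumr_ge0 => ? _); rewrite !mulr_ge0 // addr_ge0.
have QC e : 0 < e -> 0 <= Q + e * C.
  move=> e0; apply: le_trans (Qw e e0) _.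
  rewrite mulr_sumr -big_split; apply: ler_sum => u _ /=.
  rewrite mulr_sumr -big_split; apply: ler_sum => v _ /=.
  rewrite [e * _]mulrCA -mulrDr; apply: ler_wpM2l => //.
  rewrite -lerBlDl -[X in _ - X]mulr1 -mulrBr; apply: le_trans (ler_norm _) _.
  rewrite normrM mulrCA; apply: ler_wpM2l => //.
  exact: tilt_weight_le.
apply/ler_addgt0Pr => e e0; have C1 : 0 < C + 1 by rewrite ltr_wpDl.
apply: le_trans (QC (e / (C + 1)) (divr_gt0 e0 C1)) _.
by rewrite lerD2l -mulrA ler_piMr ?ltW // mulrC ltr_pdivrMr // mul1r ltrDl.
Qed.

(** Test the slack matrix on k delta_u - delta_v: its quadratic form there is
k^2 g_u - 2 k + g_v, which is negative for large k if g_u <= 0. *)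
Lemma gain_gt0 u v : adj u v -> 0 < gain s u.
Proof.
move=> uv; have nuv : v != u.
  by apply: contraTneq uv => ->; rewrite adj_irrefl.
rewrite ltNge; apply/negP => g0.
pose k : R := `|gain s v| + 1.
have k0 : 0 < k by rewrite ltr_wpDl.
pose x w : R := (w == u)%:R * k - (w == v)%:R.
have := sum_slack_ge0 (psdker_rank1 x).
have step (F : G -> R) : \sum_w F w * x w = k * F u - F v.
  rewrite -(sum_delta F v) -[k * F u](sum_delta (fun w => k * F w)).
  rewrite -sumrB.
  by apply: eq_bigr => w _; rewrite /x; ring.
have -> : \sum_a \sum_b slack s a b * rank1 x a b
    = k * (k * slack s u u - slack s u v) - (k * slack s v u - slack s v v).
  rewrite -(step (slack s v)) -(step (slack s u)).
  rewrite -(step (fun a => \sum_w slack s a w * x w)).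
  apply: eq_bigr => a _; rewrite mulr_suml; apply: eq_bigr => b _.
  by rewrite /rank1; ring.
rewrite /slack /weight !eqxx !adj_irrefl (negPf nuv) eq_sym (negPf nuv).
rewrite [adj v u]adj_sym uv !mul0r !mul1r !add0r !addr0 mulr1 /=.
have kv : gain s v < k by rewrite ltr_pwDr // ler_norm.
have : k * (k * gain s u) <= 0 by rewrite !pmulr_rle0.
lra.
Qed.

End OptimalCut.

Lemma gain_side_int S u : gain (side S) u \is a Num.int.
Proof.
rewrite rpredN; apply: rpred_sum => v _.
by rewrite rpredM ?rpredM ?rpredX ?rpredN ?rpred1 // natr_int.
Qed.

End Cuts.

(** * Lexicographic products *)

Section Lexprod.
Variables (R : realType) (G H : sgraph).
Local Notation m := #|H|.

Lemma sum_lexprod (F : lexprod G H -> R) :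
  \sum_p F p = \sum_u \sum_v F (u, v).
Proof. by rewrite pair_bigA; apply: eq_bigr => -[]. Qed.

Lemma weight_lexprod (u u' : G) (v v' : H) :
  weight R ((u, v) : lexprod G H) (u', v')
  = weight R u u' + (u' == u)%:R * weight R v v'.
Proof.
rewrite /weight /= /lex_adj /= eq_sym.
case: eqP => [->|_]; last by rewrite orbF mul0r addr0.
by rewrite adj_irrefl mul1r add0r.
Qed.

(** Each edge of [G] cut by [S] gives m^2 edges of the product cut by S x H. *)
Lemma maxcut_lexprod_ge : (m ^ 2 * maxcut G <= maxcut (lexprod G H))%N.
Proof.
have [S ->] := maxcut_attained G.
pose S' : {set lexprod G H} := [set p | p.1 \in S].
apply: leq_trans (leq_bigmax S'); rewrite !card_cut_edges.
set B := [set p : G * G | _].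
pose f (t : (H * H) * (G * G)) : lexprod G H * lexprod G H :=
  ((t.2.1, t.1.1), (t.2.2, t.1.2)).
have f_inj : injective f by move=> [[a b] [c d]] [[? ?] [? ?]] [-> -> -> ->].
have -> : (m ^ 2 * #|B| = #|setX [set: H * H] B|)%N.
  by rewrite cardsX cardsT card_prod mulnn.
rewrite -(card_imset _ f_inj).
apply/subset_leq_card/subsetP => _ /imsetP[t + ->].
rewrite !inE /= => /and3P[tA t1 t2].
by rewrite /lex_adj /= tA t1 t2.
Qed.

Definition fibre_mean (M : lexprod G H -> lexprod G H -> R) : G -> G -> R :=
  fun u u' => (m%:R ^+ 2)^-1 * \sum_v \sum_v' M (u, v) (u', v').

Lemma m_gt0 : 0 < m%:R :> R.
Proof. by rewrite ltr0n vertex_gt0. Qed.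

Lemma m2_gt0 : 0 < m%:R ^+ 2 :> R.
Proof. by rewrite exprn_gt0 // m_gt0. Qed.

(** The quadratic form of the mean is, up to a positive factor, that of [M] on
vectors constant along fibres. *)
Lemma psdker_fibre_mean M : psdker M -> psdker (fibre_mean M).
Proof.
move=> [Ms Mp]; apply: psdkerZ; first by rewrite invr_ge0 ltW // m2_gt0.
split=> [u u'|x].
  by rewrite exchange_big; do 2!(apply: eq_bigr => ? _).
apply: le_trans (Mp (fun p => x p.1)) _; rewrite le_eqVlt; apply/orP; left.
apply/eqP; rewrite /quad.
rewrite sum_lexprod; apply: eq_bigr => u _ /=.
under eq_bigr => v _ do rewrite sum_lexprod.
rewrite exchange_big; apply: eq_bigr => u' _ /=.
rewrite mulr_sumr mulr_suml; apply: eq_bigr => v _.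
by rewrite mulr_sumr mulr_suml.
Qed.

Lemma sum_fibre1B M u u' :
  \sum_v \sum_v' (1 - M (u, v) (u', v')) = m%:R ^+ 2 * (1 - fibre_mean M u u').
Proof.
rewrite mulrBr mulr1 /fibre_mean mulVKf ?gt_eqF ?m2_gt0 //.
under eq_bigr => v _ do rewrite sumrB sumr_const.
by rewrite sumrB sumr_const -mulrnA -natrX mulnn.
Qed.

Lemma fibre_mean_le1 M u : elliptope M -> fibre_mean M u u <= 1.
Proof.
move=> Me; rewrite -subr_ge0 -(pmulr_rge0 _ m2_gt0) -sum_fibre1B.
by do 2!(apply: sumr_ge0 => ? _); rewrite subr_ge0; exact: (elliptope_le1 _ _ Me).
Qed.

(** Entries of [M] are at most 1, so the weights of [H] inside a fibre may be
replaced by 1; the fibre sums then depend on the mean alone. *)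
Lemma cutform_lexprod_le M : elliptope M ->
  cutform M <= m%:R ^+ 2 * (cutform (fibre_mean M)
                            + 4^-1 * \sum_u (1 - fibre_mean M u u)).
Proof.
move=> Me; rewrite /cutform -mulrDr mulrCA ler_pM2l ?invr_gt0 //.
rewrite sum_lexprod -big_split mulr_sumr; apply: ler_sum => u _ /=.
under eq_bigr => v _ do rewrite sum_lexprod.
rewrite exchange_big /=.
rewrite -(sum_delta (fun u' => 1 - fibre_mean M u u') u) -big_split mulr_sumr.
apply: ler_sum => u' _ /=; rewrite -mulrDl mulrCA -sum_fibre1B mulr_sumr.
apply: ler_sum => v _; rewrite mulr_sumr; apply: ler_sum => v' _.
rewrite weight_lexprod; apply: ler_wpM2r.
  by rewrite subr_ge0; exact: (elliptope_le1 _ _ Me).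
by rewrite lerD2l ler_piMr ?ler0n // lern1 leq_b1.
Qed.

Lemma exact_lexprod :
  no_isolated_vertex G -> exact_graph R G -> exact_graph R (lexprod G H).
Proof.
move=> iso ex; apply/eqP; rewrite eq_le maxcut_le_opt andbT.
have [S mS] := maxcut_attained G.
have opt (M : G -> G -> R) : elliptope M -> cutform M <= cutform (rank1 (side R S)).
  by rewrite cutform_side -mS -ex; exact: cutform_le_opt.
have gain_ge1 u : 1 <= gain (side R S) u.
  have [v uv] := iso u.
  have g0 := gain_gt0 (side_sqr R S) opt uv.
  by rewrite -(gtr0_norm g0) norm_intr_ge1 ?gain_side_int ?gt_eqF.
apply: (@le_trans _ _ ((m ^ 2 * maxcut G)%N%:R)); last first.
  by rewrite ler_nat maxcut_lexprod_ge.
rewrite natrM natrX; apply: sdp_opt_le => M Me.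
apply: le_trans (cutform_lexprod_le Me) _; rewrite ler_pM2l ?m2_gt0 //.
have := sum_slack_ge0 (side_sqr R S) opt (psdker_fibre_mean (proj1 Me)).
rewrite sum_slackE mS -cutform_side => slack0.
have := cutform_gain (side R S).
have : 0 <= \sum_u (gain (side R S) u - 1) * (1 - fibre_mean M u u).
  apply: sumr_ge0 => u _; rewrite mulr_ge0 ?subr_ge0 //.
  exact: fibre_mean_le1.
have -> : \sum_u (gain (side R S) u - 1) * (1 - fibre_mean M u u) =
    \sum_u gain (side R S) u - \sum_u gain (side R S) u * fibre_mean M u u
    - \sum_u (1 - fibre_mean M u u).
  by rewrite -!sumrB; apply: eq_bigr => u _; ring.
have -> : cutform (fibre_mean M) = 4^-1 *
   (\sum_u \sum_v @weight R G u v
    - \sum_u \sum_v @weight R G u v * fibre_mean M u v).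
  rewrite -sumrB; congr (_ * _); apply: eq_bigr => u _.
  by rewrite -sumrB; apply: eq_bigr => v _; ring.
lra.
Qed.

Lemma no_isolated_lexprod :
  no_isolated_vertex G -> no_isolated_vertex (lexprod G H).
Proof.
move=> iso [u v]; have [u' uu'] := iso u.
by exists (u', v); rewrite /= /lex_adj /= uu'.
Qed.

End Lexprod.

Lemma exact_foldl_lexprod (R : realType) (Hs : seq sgraph) (G : sgraph) :
  no_isolated_vertex G -> exact_graph R G -> exact_graph R (foldl lexprod G Hs).
Proof.
elim: Hs G => [|H Hs IHs] G iso ex //=.
by apply: IHs; [exact: no_isolated_lexprod | exact: exact_lexprod].
Qed.

Theorem corollary13 (R : realType) (n : nat) (hn : (2 <= n)%N)
    (G : nat -> sgraph)
    (hiso : no_isolated_vertex (G 1%N))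
    (hexact : exact_graph R (G 1%N)) :
  exact_graph R (lexprod_iter G n).
Proof. exact: exact_foldl_lexprod. Qed.
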